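(* Let $X$ be a paracompact $C$-space and let $C$ be a convex subset of a Banach space. Suppose that to each $x\in X$ a $Z$-set $Z(x)$ of $C$ and a nonempty convex subset $U(x)$ of $C$ are assigned so that the set $\bigcup_{x\in X}\{x\}\times Z(x)$ is closed in $X\times C$ and the set $\bigcup_{x\in X}\{x\}\times U(x)$ is open in $X\times C$. Then there exists a continuous map $f:X\to C$ such that $f(x)\in U(x)\setminus Z(x)$ for every $x\in X$.
   Context: A space $X$ is a $C$-space (has property $C$) if for every sequence $\{\alpha_n:n\in\omega\}$ of open covers of $X$ there is a sequence $\{\mu_n:n\in\omega\}$, where each $\mu_n$ is a family of pairwise disjoint open subsets of $X$ refining $\alpha_n$, such that $\bigcup_{n\in\omega}\mu_n$ covers $X$. For topological spaces $K,T$, $C(K,T)$ denotes the space of continuous maps $K\to T$ with the compact-open topology. A closed subset $F$ of a topological space $T$ is a $Z$-set in $T$ if for every compact (Hausdorff) space $K$ the set $C(K,T\setminus F)$ is dense in $C(K,T)$. Here $C$ carries the norm topology. *)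

(* Defs.v *)
From HB Require Import structures.
From mathcomp Require Import all_boot all_order all_algebra.
From mathcomp Require Import all_classical all_reals all_analysis.
Set Implicit Arguments. Unset Strict Implicit. Unset Printing Implicit Defensive.
Import Order.TTheory GRing.Theory Num.Theory.
Import numFieldNormedType.Exports.
Local Open Scope classical_set_scope.
Local Open Scope ring_scope.

Definition open_family {X : topologicalType} (F : set (set X)) :=
  forall A, F A -> open A.

Definition covers {X : Type} (F : set (set X)) :=
  forall x : X, exists2 A, F A & A x.

Definition refines {X : Type} (mu alpha : set (set X)) :=
  forall A, mu A -> exists2 B, alpha B & A `<=` B.

Definition locally_finite_family {X : topologicalType} (F : set (set X)) :=
  forall x : X, exists2 N, nbhs x N & finite_set [set A | F A /\ A `&` N !=set0].

(* paracompact (Engelking convention: Hausdorff + every open cover has a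
   locally finite open refinement which covers) *)
Definition paracompact (X : topologicalType) :=
  hausdorff_space X /\
  forall alpha : set (set X), open_family alpha -> covers alpha ->
    exists mu : set (set X),
      [/\ open_family mu, covers mu, refines mu alpha & locally_finite_family mu].

Definition pairwise_disjoint_family {X : Type} (mu : set (set X)) :=
  forall A B, mu A -> mu B -> A <> B -> A `&` B = set0.

Definition C_space (X : topologicalType) :=
  forall alpha : nat -> set (set X),
    (forall n, open_family (alpha n) /\ covers (alpha n)) ->
    exists mu : nat -> set (set X),
      (forall n, [/\ open_family (mu n), pairwise_disjoint_family (mu n)
                   & refines (mu n) (alpha n)]) /\
      covers (\bigcup_n mu n).

Definition convex_subset {R : numDomainType} {V : lmodType R} (C : set V) :=
  forall x y (t : R), C x -> C y -> 0 <= t -> t <= 1 ->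
    C (t *: x + (1 - t) *: y).

Definition rel_closed {Y : topologicalType} (T F : set Y) :=
  F `<=` T /\ exists2 G, closed G & F = G `&` T.

Definition rel_open {Y : topologicalType} (T W : set Y) :=
  W `<=` T /\ exists2 G, open G & W = G `&` T.

(* Z-set in a subset T of a normed space V (T with the norm topology).
   C(K,T) is represented by continuous maps K -> V with range in T;
   since K is compact and T is metric, the compact-open topology on C(K,T)
   is the topology of uniform convergence, so density of C(K, T \ F) is
   expressed uniformly. *)
Definition Z_set {R : realType} {V : normedModType R} (T F : set V) :=
  rel_closed T F /\
  forall (K : topologicalType), compact [set: K] -> hausdorff_space K ->
    forall g : K -> V, continuous g -> (forall k, T (g k)) ->
    forall eps : R, 0 < eps ->
      exists h : K -> V, [/\ continuous h, (forall k, (T `\` F) (h k))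
                          & forall k, `|g k - h k| < eps].

(* Main.v *)
Require Import Defs.
From HB Require Import structures.
From mathcomp Require Import all_boot all_order all_algebra.
From mathcomp Require Import all_classical all_reals all_analysis.
From mathcomp Require Import lra.
Set Implicit Arguments. Unset Strict Implicit. Unset Printing Implicit Defensive.
Import Order.TTheory GRing.Theory Num.Theory.
Import numFieldNormedType.Exports.
Local Open Scope classical_set_scope.
Local Open Scope ring_scope.

(* Put Phi x = U x \ Z x. Every compact K in Phi x contracts to a point inside
   Phi x: the straight contraction stays in the convex set U x, the Z-set
   property pushes it off Z x, and the push can be damped to zero near the two
   ends, where the straight contraction is off Z x anyway.  Moreover K stays in
   Phi y for y near x.
   The covers fed to property C must be chosen in advance, before the disjoint
   refinements are known.  This is achieved by tracking all values that a
   selection built so far could take: P n x contains every point obtainable at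
   x with the first n families of contractions, and local finiteness keeps P n
   locally inside compact subsets of Phi.  Each member of the n-th cover then
   carries one contraction valid for all of P n.  Given the disjoint refinements
   and bump functions lam n subordinate to their unions,
   f (n+1) x = h_M (f n x, lam n x) on the member M of the n-th refinement
   containing x: where lam n = 1 the value is constant whatever f n was, where
   lam n = 0 nothing changes, and the sequence is locally eventually constant. *)

(** * Paracompact spaces: closures, separation and bump functions *)

Lemma filter_forall_finite {T : Type} {I : choiceType} {F : set_system T}
  (FF : Filter F) (D : set I) (P : I -> T -> Prop) :
  finite_set D -> (forall i, D i -> \forall y \near F, P i y) ->
  \forall y \near F, forall i, D i -> P i y.
Proof.
move=> /finite_fsetP[E ->] DP.
by apply: filterS (@filter_bigI _ _ E P F FF DP) => y Py i /Py.
Qed.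

Lemma closure_bigcup_locally_finite {X : topologicalType} (F : set (set X)) :
  locally_finite_family F ->
  closure (\bigcup_(A in F) A) `<=` \bigcup_(A in F) closure A.
Proof.
move=> lfF x clx; apply: contrapT => nx.
have [N Nx finN] := lfF x.
have : nbhs x (fun y => forall A, F A /\ A `&` N !=set0 -> ~ closure A y).
  apply: filter_forall_finite => // A [FA _].
  apply: open_nbhs_nbhs; split; first exact/closed_openC/closed_closure.
  by move=> clA; apply: nx; exists A.
move=> /(filterI Nx) /clx [y [[A FA Ay] [Ny]]].
apply; last exact: subset_closure Ay.
by split=> //; exists y.
Qed.

(** Refine the cover made of the complement of [B] and the open sets whose closure misses [A]; [W]
    is the union of the members meeting [B], and local finiteness puts its closure in the union of
    theirs. A point as [A] gives regularity, which then supplies the hypothesis for normality. *)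
Lemma paracompact_separate {X : topologicalType} (A B : set X) :
  paracompact X -> closed B ->
  (forall y, B y -> exists O, [/\ open O, O y & closure O `&` A = set0]) ->
  exists W, [/\ open W, B `<=` W & closure W `&` A = set0].
Proof.
move=> [_ pX] cB sepB.
have [||mu [omu cmu rmu lmu]] := pX [set O | open O /\
    (O = ~` B \/ closure O `&` A = set0)].
- by move=> O [].
- move=> x; have [/sepB [ O [oO Ox OA]] | nBx] := pselect (B x).
    by exists O => //; split=> //; right.
  by exists (~` B) => //; split; [exact: closed_openC|left].
exists (\bigcup_(O in [set O | mu O /\ O `&` B !=set0]) O); split.
- by apply: bigcup_open => O [/omu].
- move=> y By; have [ O muO Oy] := cmu y.
  by exists O => //; split=> //; exists y.
- rewrite -subset0 => x [clx Ax].
  have /closure_bigcup_locally_finite/(_ _ clx) [ O [muO [y [Oy By]]] clO] :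
      locally_finite_family [set O | mu O /\ O `&` B !=set0].
    move=> z; have [N Nz fN] := lmu z; exists N => //.
    by apply: sub_finite_set fN => O [[? _] ?].
  have [ O' [_ [ O'B | O'A] ] OO'] := rmu _ muO.
    by move: (OO' _ Oy); rewrite O'B.
  by rewrite -O'A; split=> //; exact: (closure_subset OO').
Qed.

Lemma paracompact_regular {X : topologicalType} (x : X) (O : set X) :
  paracompact X -> open O -> O x ->
  exists O', [/\ open O', O' x & closure O' `<=` O].
Proof.
move=> pX oO Ox.
have [|||W [oW OW Wx]] := @paracompact_separate X [set x] (~` O) => //.
- exact: open_closedC.
- move=> y Oy; have xy : x != y by apply/eqP => xy; apply: Oy; rewrite -xy.
  have := pX.1; rewrite open_hausdorff => /(_ _ _ xy)[[G H]]/=.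
  rewrite !inE => -[Gx Hy] [oG oH GH].
  exists H; split=> //; rewrite -subset0 => z [+ zx].
  rewrite zx => /(_ G (open_nbhs_nbhs (conj oG Gx)))[w [Hw Gw]].
  by have : (G `&` H) w by []; rewrite GH.
exists (~` closure W); split.
- exact/closed_openC/closed_closure.
- by move=> clx; have : (closure W `&` [set x]) x by []; rewrite Wx.
- move=> y cly; apply: contrapT => /OW Wy.
  have [|z [/= nz Wz]] := cly W; first by apply: open_nbhs_nbhs; split.
  exact/nz/subset_closure.
Qed.

Lemma paracompact_normal {X : topologicalType} :
  paracompact X -> normal_space X.
Proof.
move=> pX A cA G /set_nbhsP[ O [oO AO OG]].
have [|||W [oW AW WO]] := @paracompact_separate X (~` O) A => //.
  move=> y /AO Oy; have [ O' [oO' O'y O'O]] := paracompact_regular pX oO Oy.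
  by exists O'; split=> //; apply/disjoints_subset; rewrite setCK.
exists W; first by apply/set_nbhsP; exists W; split.
by apply: subset_trans OG; rewrite -(setCK O); apply/disjoints_subset.
Qed.

Lemma paracompact_closure_refinement {X : topologicalType}
  (alpha : set (set X)) :
  paracompact X -> open_family alpha -> covers alpha ->
  exists mu : set (set X),
    [/\ open_family mu, covers mu, locally_finite_family mu
      & forall A, mu A -> exists2 B, alpha B & closure A `<=` B].
Proof.
move=> pX oa ca.
have [||mu [omu cmu rmu lmu]] :=
  pX.2 [set O | open O /\ exists2 B, alpha B & closure O `<=` B].
- by move=> O [].
- move=> x; have [B aB Bx] := ca x.
  have [ O [oO Ox OB]] := paracompact_regular pX (oa _ aB) Bx.
  by exists O => //; split=> //; exists B.
exists mu; split=> // A /rmu[ O [_ [B aB OB]] AO].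
by exists B => //; apply: subset_trans OB; exact: closure_subset.
Qed.

(** Members of a locally finite refinement are grouped by the index of some [O n] containing their
    closure; a neighbourhood meeting finitely many members meets finitely many groups. *)
Lemma paracompact_shrinking {X : topologicalType} (O : nat -> set X) :
  paracompact X -> (forall n, open (O n)) -> (forall x, exists n, O n x) ->
  exists B : nat -> set X, [/\ forall n, open (B n),
    forall x, exists n, B n x, forall n, closure (B n) `<=` O n &
    forall x : X, exists2 N, nbhs x N & exists m, forall n, (m <= n)%N ->
      B n `&` N = set0].
Proof.
move=> pX oO cO.
have [||mu [omu cmu lmu rmu]] := @paracompact_closure_refinement X (range O) pX.
- by move=> _ [n _ <-].
- by move=> x; have [n Onx] := cO x; exists (O n) => //; exists n.
have /choice[idx idxP] : forall A, exists n, mu A -> closure A `<=` O n.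
  move=> A; have [/rmu [_ [n _ <-] AO]|nA] := pselect (mu A); first by exists n.
  by exists 0%N.
exists (fun n => \bigcup_(A in [set A | mu A /\ idx A = n]) A); split.
- by move=> n; apply: bigcup_open => A [/omu].
- by move=> x; have [A muA Ax] := cmu x; exists (idx A); exists A.
- move=> n x; move=> /closure_bigcup_locally_finite[].
    move=> z; have [N Nz fN] := lmu z; exists N => //.
    by apply: sub_finite_set fN => A [[? _] ?].
  by move=> A [muA <-]; exact: idxP.
- move=> x; have [N Nx fN] := lmu x; exists N => //.
  have [m _ Pm] : \forall m \near \oo,
      forall A, mu A /\ A `&` N !=set0 -> (idx A < m)%N.
    by apply: filter_forall_finite => // A _; exists (idx A).+1.
  exists m => n mn; rewrite -subset0 => y [[A [muA An] Ay] Ny].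
  suff : (idx A < n)%N by rewrite An ltnn.
  apply: Pm => //.
  by split=> //; exists y.
Qed.

(** Two successive shrinkings leave room for Urysohn functions, 1 on [Q n] and 0 off [B n]. As
    [closure (B n)] lies in [O n], [lam n] vanishes near, not just at, each point outside [O n]. *)
Lemma paracompact_bump {R : realType} {X : topologicalType} (O : nat -> set X) :
  paracompact X -> (forall n, open (O n)) -> (forall x, exists n, O n x) ->
  exists lam : nat -> X -> R, [/\ forall n, continuous (lam n),
    forall n x, `[0, 1]%classic (lam n x),
    forall x : X, exists n, \forall y \near x, lam n y = 1,
    forall n (x : X), ~ O n x -> \forall y \near x, lam n y = 0 &
    forall x : X, \forall y \near x & n \near \oo, lam n y = 0].
Proof.
move=> pX oO cO.
have [B [oB cB BO lB]] := paracompact_shrinking pX oO cO.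
have [Q [oQ cQ QB _]] := paracompact_shrinking pX oB cB.
have /choice[lam lamP] : forall n, exists f : X -> R, [/\ continuous f,
    forall x, `[0, 1]%classic (f x), forall x, ~ B n x -> f x = 0 &
    forall x, Q n x -> f x = 1].
  move=> n; have [|||f [cf f0 f1 f01]] := @urysohn_ext_itv X R
      (paracompact_normal pX) (~` B n) (closure (Q n)) 0 1 _ _ _ ltr01.
  - exact: open_closedC.
  - exact: closed_closure.
  - by rewrite setIC; apply/disjoints_subset; rewrite setCK.
  exists f; split=> // x.
  - by apply: f01; exists x.
  - by move=> Bx; apply: f0; exists x.
  - by move=> Qx; apply: f1; exists x => //; exact: subset_closure.
exists lam; split=> [n|n|x|n x nO|x]; do 1?by have [] := lamP n.
- have [n Qn] := cQ x; exists n; have [_ _ _ l1] := lamP n.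
  by apply: filterS (open_nbhs_nbhs (conj (oQ n) Qn)); exact: l1.
- have [_ _ l0 _] := lamP n.
  have : nbhs x (~` closure (B n)).
    apply: open_nbhs_nbhs; split; first exact/closed_openC/closed_closure.
    by move=> /BO.
  by apply: filterS => y ny; apply: l0 => By; exact/ny/subset_closure.
- have [N Nx [m mP]] := lB x.
  exists (N, [set n | (m <= n)%N]) => /=.
    by split=> //; exists m.
  move=> [y n] /= [Ny mn]; have [_ _ l0 _] := lamP n.
  by apply: l0 => By; have : (B n `&` N) y by []; rewrite mP.
Qed.

(** * Z-sets on compact subsets, and contractions avoiding them *)

Lemma compact_set_type {T : topologicalType} (L : set T) :
  compact L -> compact [set: L].
Proof.
move=> cL G PG _.
have GL : (set_val @ G) L by apply: (@filterE _ G) => y; exact: set_valP.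
have [x [Lx clx]] := cL _ (fmap_proper_filter set_val PG) GL.
exists (exist _ x (mem_set Lx)); split=> // A B GA [_ [[W oW <-] /= Wx] WB].
have GA' : (set_val @ G) (set_val @` A).
  by apply: (@filterS _ G _ A) => // y Ay; exists y.
have [_ [[y Ay <-] Wy]] := clx _ _ GA' (open_nbhs_nbhs (conj oW Wx)).
by exists y; split=> //; exact: WB.
Qed.

Lemma hausdorff_set_type {T : topologicalType} (L : set T) :
  hausdorff_space T -> hausdorff_space L.
Proof.
move=> hT p q clpq; apply/val_inj/hT => A B.
move=> /(@initial_continuous _ _ set_val p) Ap.
move=> /(@initial_continuous _ _ set_val q) Bq.
by have [y [Ay By]] := clpq _ _ Ap Bq; exists (set_val y).
Qed.

(** Passes from compact Hausdorff spaces to compact subsets: the approximation on the subtype [L] is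
    extended by 0, hence continuity only within [L]. *)
Lemma Z_set_within {R : realType} {V : normedModType R} {T : topologicalType}
  (C F : set V) (L : set T) (g : T -> V) (eps : R) :
  hausdorff_space T -> Z_set C F -> compact L -> {within L, continuous g} ->
  (forall x, L x -> C (g x)) -> 0 < eps ->
  exists h : T -> V, {within L, continuous h} /\
    forall x, L x -> (C `\` F) (h x) /\ `|g x - h x| < eps.
Proof.
move=> hT [_ ZF] cL /subspace_sigL_continuousP cg gC e0.
have [|h [ch hC gh]] := ZF _ (compact_set_type cL) (hausdorff_set_type hT)
  _ cg _ _ e0.
  by move=> k; apply: gC; exact: set_valP.
have hE x (Lx : L x) : valL_ (0 : V) h x = h (exist _ x (mem_set Lx)).
  by rewrite -[in RHS](@valLK _ _ (0 : V) L h).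
exists (valL_ (0 : V) h); split; first exact/subspace_valL_continuousP'.
move=> x Lx; rewrite hE.
by split; [exact: hC|exact: (gh (exist _ x (mem_set Lx)))].
Qed.

Lemma compact_open_margin {R : realType} {V : normedModType R} (K W : set V) :
  compact K -> open W -> K `<=` W ->
  exists2 r : R, 0 < r & forall v w, K v -> `|v - w| < r -> W w.
Proof.
move=> /compact_near_coveringP cK oW KW.
have : \forall r \near 0^'+, K `<=` (fun v => forall w, `|v - w| < r -> W w).
  apply: cK => v /KW Wv.
  have /nbhs_ballP[e /= e0 eW] : nbhs v W by exact: open_nbhs_nbhs.
  exists (ball v (e / 2), [set r | r < e / 2]) => /=.
    split; first by apply: nbhsx_ballx; rewrite divr_gt0.
    by apply: nbhs_right_lt; rewrite divr_gt0.
  move=> [v' r] /= [vv' re] w v'w; apply: eW.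
  rewrite (splitr e); apply: ball_triangle vv' _; rewrite -ball_normE/=.
  exact: lt_trans re.
move=> /(filterI (nbhs_right_gt 0)) /filter_ex [r [r0 rP]].
by exists r => // v w Kv; exact: rP.
Qed.

(* The values at t = 0 and t = 1 are prescribed for every v, not only on K, so
   that h may be fed arguments about which nothing is known. *)
Definition contraction_in {R : realType} {V : topologicalType} (K S : set V)
  (p : V) (h : V * R -> V) :=
  [/\ S p, {within K `*` `[0, 1]%classic, continuous h},
    forall v, h (v, 0) = v, forall v, h (v, 1) = p &
    forall v t, K v -> `[0, 1]%classic t -> S (h (v, t))].

Lemma Z_set_contraction {R : realType} {V : normedModType R} (C Z U K : set V) :
  convex_subset C -> Z_set C Z -> convex_subset U -> rel_open C U ->
  U !=set0 -> compact K -> K `<=` U `\` Z ->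
  exists p (h : V * R -> V), contraction_in K (U `\` Z) p h.
Proof.
move=> cvxC zZ cvxU [UC [W oW UE]] [u Uu] cK KUZ.
have [_ [F cF ZE]] := zZ.1.
have UP v : C v -> W v -> U v by rewrite UE.
have UW : U `<=` W by rewrite UE => v [].
have ZP v : C v -> ~ F v -> ~ Z v by rewrite ZE => _ ? [].
have ZF v : C v -> ~ Z v -> ~ F v by rewrite ZE => Cv ZFC Fv; apply: ZFC.
(* The Z-set property on the single point [u] moves it off [Z]; the margin [r] keeps it in [U]. *)
have [p [Up Zp]] : (U `\` Z) !=set0.
  have [|r r0 rW] := @compact_open_margin R V [set u] W
    (@compact_set1 _ u) oW _.
    by move=> _ ->; exact: UW.
  have [|_ ->|h [_ hP]] := @Z_set_within R V V C Z [set u] id r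
      (@norm_hausdorff _ _)
      zZ (@compact_set1 _ u) _ _ r0.
  - by apply: continuous_subspaceT => x; exact: cvg_id.
  - exact: UC.
  have [[Ch Zh] uh] := hP u erefl.
  by exists (h u); split=> //; apply: UP => //; exact: rW uh.
pose L : set (V * R) := K `*` `[0, 1]%classic.
have cL : compact L by apply: compact_setX => //; exact: segment_compact.
pose g (x : V * R) : V := x.2 *: p + (1 - x.2) *: x.1.
have cg : continuous g.
  move=> x; apply: cvgD; apply: cvgZ.
  - exact: cvg_snd.
  - exact: cvg_cst.
  - by apply: cvgB; [exact: cvg_cst|exact: cvg_snd].
  - exact: cvg_fst.
have gU x : L x -> U (g x).
  by move=> [/KUZ[Ux _]] /=; rewrite in_itv/= => /andP[t0 t1]; exact: cvxU.
(* [r1] keeps both ends, [K] and [p], clear of [F]; [r2] keeps perturbations of the segments inside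
   [W]. *)
have [|||r1 r10 r1F] := @compact_open_margin R V (K `|` [set p]) (~` F).
- by apply: compactU => //; exact: compact_set1.
- exact: closed_openC.
- by move=> v [/KUZ[/UC Cv Zv]|->]; [exact: ZF|exact: ZF (UC _ Up) Zp].
have [|||r2 r20 r2W] := @compact_open_margin R V (g @` L) W.
- by apply: continuous_compact => //; exact: continuous_subspaceT.
- by [].
- by move=> _ [x Lx <-]; exact/UW/gU.
have [M M0 KM] : exists2 M : R, 0 < M & forall v, K v -> `|p - v| <= M.
  have [N [_ NK]] := compact_bounded cK.
  exists (`|p| + (`|N| + 1)) => [|v Kv]; first by rewrite ltr_wpDl// ltr_wpDl.
  apply: (le_trans (ler_normB _ _)); rewrite lerD2l; apply: NK => //.
  by rewrite (le_lt_trans (ler_norm _))// ltrDl.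
(* Within time [d] of an end, [g] is less than [r1 / 2] away from that end. *)
pose d := r1 / 4 / M.
have d0 : 0 < d by rewrite !divr_gt0.
have dM : d * M < r1 / 2 by rewrite divfK ?gt_eqF//; clear -r10; lra.
have [||h [ch hP]] := @Z_set_within R V (V * R)%type C Z L g
    (Num.min (r1 / 2) r2)
    _ zZ cL (continuous_subspaceT cg) (fun x Lx => UC _ (gU x Lx)) _.
- exact: norm_hausdorff.
- by rewrite lt_min r20 divr_gt0.
(* [s] damps the push: the homotopy is [g] at times 0 and 1, where [s] is 1, and [h] on
   [[d, 1 - d]], where [s] is 0. *)
have [||||s [cs smid s1 s01]] := @urysohn_ext_itv R R (@pseudometric_normal R R)
    `[d, 1 - d]%classic ([set 0] `|` [set 1]) 0 1.
- exact: itv_closed.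
- have R1 := hausdorff_accessible (@norm_hausdorff _ R^o).
  by apply: closedU; exact: accessible_closed_set1 R1 _.
- rewrite -subset0 => t [/=]; rewrite in_itv/= => /andP[dt td].
  by move=> [] tE; clear -d0 dt td tE; lra.
- exact: ltr01.
have s_0 : s 0 = 1 by apply: s1; exists 0 => //; left.
have s_1 : s 1 = 1 by apply: s1; exists 1 => //; right.
have s_mid t : d <= t -> d <= 1 - t -> s t = 0.
  move=> dt dt1; apply: smid; exists t => //=; rewrite in_itv/= dt/=.
  by clear -dt1; lra.
have s_01 t : 0 <= s t <= 1.
  by have := s01 (s t); rewrite /= in_itv/=; apply; exists t.
exists p, (fun x => s x.2 *: g x + (1 - s x.2) *: h x); split=> //.
- have cs2 : {within L, continuous (fun x => s x.2)}.
    apply: continuous_subspaceT => x.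
    by apply: continuous_comp; [exact: cvg_snd|exact: cs].
  move=> x; apply: cvgD; apply: cvgZ.
  + exact: cs2.
  + exact: continuous_subspaceT.
  + by apply: cvgB; [exact: cvg_cst|exact: cs2].
  + exact: ch.
- by move=> v; rewrite /g/= s_0 subrr !scale0r addr0 add0r subr0 !scale1r.
- by move=> v; rewrite /g/= s_1 subrr !scale0r !addr0 !scale1r.
move=> v t Kv; rewrite /= in_itv/= => t01.
have Lx : L (v, t) by split=> //=; rewrite in_itv.
have [[Chx Zhx]] := hP _ Lx.
rewrite lt_min => /andP[gh1 gh2].
have /andP[st0 st1] := s_01 t.
set x := (v, t) in Lx Chx Zhx gh1 gh2 *.
set H := _ + _.
have CH : C H by apply: cvxC => //; exact/UC/gU.
have gH : `|g x - H| <= `|g x - h x|.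
  have -> : g x - H = (1 - s t) *: (g x - h x).
    rewrite /H scalerBr scalerBl scale1r scalerBl scale1r.
    by rewrite opprD addrA opprB addrA.
  rewrite normrZ ger0_norm; last by rewrite subr_ge0.
  by rewrite ler_piMl// gerBl.
split.
  by apply: UP => //; apply: (r2W (g x)); [exists x|exact: le_lt_trans gH gh2].
(* In the middle the value is [h x], off [Z]. Near an end it is within [r1 / 2] of [g x], itself
   within [r1 / 2] of [v] or [p], so [r1] keeps it off [F]. *)
have [/andP[dt dt1]|] := boolP ((d <= t) && (d <= 1 - t)).
  by rewrite /H /= s_mid// scale0r add0r subr0 scale1r.
rewrite negb_and -!ltNge => /orP[td|td]; apply: ZP => //.
- apply: (r1F v); first by left.
  rewrite -(subrKA (g x)) (le_lt_trans (ler_normD _ _))// (splitr r1).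
  rewrite ltrD ?(le_lt_trans gH)//.
  have -> : v - g x = - (t *: (p - v)).
    rewrite /g/= scalerBl scale1r opprD opprB scalerBr opprB.
    by rewrite addrCA (addrC v) subrK addrC.
  rewrite normrN normrZ ger0_norm; last by case/andP: t01.
  apply: le_lt_trans dM; apply: ler_pM => //; last exact: KM.
    by case/andP: t01.
  exact: ltW.
- apply: (r1F p); first by right.
  rewrite -(subrKA (g x)) (le_lt_trans (ler_normD _ _))// (splitr r1).
  rewrite ltrD ?(le_lt_trans gH)//.
  have -> : p - g x = (1 - t) *: (p - v).
    by rewrite /g/= opprD addrA scalerBr !scalerBl !scale1r.
  rewrite normrZ ger0_norm; last by rewrite subr_ge0; case/andP: t01.
  apply: le_lt_trans dM; apply: ler_pM => //; last exact: KM.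
    by rewrite subr_ge0; case/andP: t01.
  exact: ltW.
Qed.

(** * Step homotopies and the selection over a C-space *)

Lemma compact_bigcup_finite {T : topologicalType} {I : choiceType} (D : set I)
  (F : I -> set T) :
  finite_set D -> (forall i, D i -> compact (F i)) ->
  compact (\bigcup_(i in D) F i).
Proof.
move=> /finite_fsetP[E ->] cF; rewrite bigcup_fset big_seq.
by apply: bigsetU_compact => i; exact: cF.
Qed.

(** The same [K] serves all [y] near [x], so one contraction of [K] treats every [P y] there. *)
Definition locally_in_compact {X V : topologicalType} (Phi P : X -> set V) :=
  forall x : X, exists K, [/\ compact K, K `<=` Phi x &
    \forall y \near x, P y `<=` K].

(** The last clause puts the endpoint in [Q y] even when the incoming value is not in [P y]; this is
    how values first enter [Q]. *)
Definition step_homotopy {R : realType} {X V : topologicalType}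
  (P Q : X -> set V) (A : set X) (h : V * R -> V) :=
  [/\ forall v, h (v, 0) = v,
    exists2 K, {within K `*` `[0, 1]%classic, continuous h} &
      forall y, A y -> P y `<=` K,
    forall y v t, A y -> P y v -> `[0, 1]%classic t -> Q y (h (v, t)) &
    exists2 p, forall v, h (v, 1) = p & forall y, A y -> Q y p].

(** The trace [L] of a contraction inside [Phi x] is compact, so it stays in [Phi y] nearby. [Q y]
    adjoins to [P y] the traces of the members containing [y]. *)
Lemma step_homotopy_cover {R : realType} {X V : topologicalType}
  (Phi P : X -> set V) :
  paracompact X ->
  (forall x K, compact K -> K `<=` Phi x -> \forall y \near x, K `<=` Phi y) ->
  (forall x K, compact K -> K `<=` Phi x ->
    exists p (h : V * R -> V), contraction_in K (Phi x) p h) ->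
  locally_in_compact Phi P ->
  exists (alpha : set (set X)) (Q : X -> set V),
    [/\ open_family alpha, covers alpha, locally_in_compact Phi Q,
      forall x, P x `<=` Q x &
      forall A, alpha A -> exists h : V * R -> V, step_homotopy P Q A h].
Proof.
move=> pX oPhi cPhi lP.
(* [Q] depends on the refinement still to be chosen, so every [Q] containing [L] over [A] is
   allowed. *)
pose good (L : set V) (h : V * R -> V) (A : set X) := forall Q : X -> set V,
  (forall y, A y -> L `<=` Q y) -> step_homotopy P Q A h.
have [||mu [omu cmu lmu rmu]] := @paracompact_closure_refinement X
  [set G | open G /\ exists L h, [/\ compact L, forall y, G y -> L `<=` Phi y &
    forall A, A `<=` G -> good L h A]] pX.
- by move=> G [].
- move=> x; have [K [cK KPhi PK]] := lP x.
  have [p [h [Pp ch h0 h1 hP]]] := cPhi x K cK KPhi.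
  (* [p] is added separately because [K] may be empty. *)
  pose L := h @` (K `*` `[0, 1]%classic) `|` [set p].
  have cL : compact L.
    apply: compactU; last exact: compact_set1.
    apply: continuous_compact => //; apply: compact_setX => //.
    exact: segment_compact.
  have LPhi : L `<=` Phi x by move=> _ [[[v t] [/= Kv It] <-]|->] //; exact: hP.
  have LK := oPhi x L cL LPhi.
  exists (interior [set y | P y `<=` K /\ L `<=` Phi y]); last exact: (filterI PK LK).
  split; first exact: open_interior.
  exists L, h; split=> // [y /interior_subset[] //|A AG Q LQ].
  have {}AG y : A y -> P y `<=` K by move=> /AG/interior_subset[].
  split=> //.
  + by exists K.
  + move=> y v t Ay Pv It; apply: LQ => //; left; exists (v, t) => //.
    by split=> //=; exact: AG Pv.
  + by exists p => // y Ay; apply: LQ => //; right.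
have /choice[d dP] : forall A, exists d : set V * (V * R -> V), mu A ->
    [/\ compact d.1, forall y, closure A y -> d.1 `<=` Phi y & good d.1 d.2 A].
  move=> A; have [muA | nA] := pselect (mu A); last by exists (set0, fst).
  have [G [_ [L [h [cL LPhi gL]]]] AG] := rmu A muA.
  exists (L, h) => _; split=> // [y /AG|]; first exact: LPhi.
  by apply: gL; apply: subset_trans AG; exact: subset_closure.
exists mu, (fun y => P y `|` \bigcup_(A in [set A | mu A /\ A y]) (d A).1).
split=> //.
- move=> x; have [K [cK KPhi PK]] := lP x.
  have [N Nx fN] := lmu x.
  (* The trace of [A] is known to lie in [Phi x] only for [x] in [closure A]; members whose closure
     misses [x] are avoided by shrinking the neighbourhood. *)
  exists (K `|` \bigcup_(A in [set A | (mu A /\ A `&` N !=set0) /\ closure A x])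
    (d A).1); split.
  + apply: compactU => //; apply: compact_bigcup_finite.
      by apply: sub_finite_set fN => A [].
    by move=> A [[muA _] _]; have [] := dP A muA.
  + move=> v [/KPhi //|[A [[muA _] clx]]].
    by have [_ + _] := dP A muA; apply.
  have near_cl : \forall y \near x, forall A, mu A /\ A `&` N !=set0 ->
      A y -> closure A x.
    apply: filter_forall_finite => // A _.
    have [clx | nclx] := pselect (closure A x); first exact: nearW.
    have : nbhs x (~` closure A).
      by apply: open_nbhs_nbhs; split=> //; exact/closed_openC/closed_closure.
    by apply: filterS => y ny /subset_closure.
  apply: filterS3 PK Nx near_cl => y PK Ny near_cl v [/PK|[A [muA Ay] LAv]].
    by left.
  have AN : mu A /\ A `&` N !=set0 by split=> //; exists y.
  by right; exists A => //; split=> //; exact: near_cl.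
- move=> A muA; exists (d A).2; have [_ _] := dP A muA; apply.
  by move=> y Ay v Lv; right; exists A.
Qed.

Lemma C_space_selection {R : realType} {X V : topologicalType}
  (Phi : X -> set V) :
  paracompact X -> C_space X ->
  (forall x K, compact K -> K `<=` Phi x -> \forall y \near x, K `<=` Phi y) ->
  (forall x K, compact K -> K `<=` Phi x ->
    exists p (h : V * R -> V), contraction_in K (Phi x) p h) ->
  exists f : X -> V, continuous f /\ forall x, Phi x (f x).
Proof.
move=> pX CX oPhi cPhi.
(* The empty compact set yields a point of each fibre; [f0] is an arbitrary start, with no
   continuity. *)
have /choice[f0 _] : forall x, exists v, Phi x v.
  by move=> x; have [p [h []]] := cPhi x set0 compact0 (@sub0set _ _); exists p.
(* [S] is total, with a default value, so that it can be iterated before property C is applied. *)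
have /choice[S SP] : forall P : X -> set V,
    exists d : set (set X) * (X -> set V), locally_in_compact Phi P ->
    [/\ open_family d.1, covers d.1, locally_in_compact Phi d.2,
      forall x, P x `<=` d.2 x &
      forall A, d.1 A -> exists h : V * R -> V, step_homotopy P d.2 A h].
  move=> P; have [lP|nP] := pselect (locally_in_compact Phi P).
    have [alpha [Q dP]] := step_homotopy_cover pX oPhi cPhi lP.
    by exists (alpha, Q).
  by exists (set0, P).
pose P := fix P n : X -> set V :=
  if n is n'.+1 then (S (P n')).2 else fun=> set0.
have lP n : locally_in_compact Phi (P n).
  elim: n => [x|n /SP[]//].
  exists set0; split; [exact: compact0|by []|by apply: nearW => y v].
have [|mu [muP cmu]] := CX (fun n => (S (P n)).1).
  by move=> n; have [] := SP _ (lP n).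
have /choice[h hP] : forall nM : nat * set X, exists h : V * R -> V,
    mu nM.1 nM.2 -> step_homotopy (P nM.1) (P nM.1.+1) nM.2 h.
  move=> [n M] /=; have [muM|nM] := pselect (mu n M); last by exists fst.
  have [_ _ rmu] := muP n; have [A aA MA] := rmu M muM.
  have [_ _ _ _ /(_ A aA)[h [h0 [K ch PK] hQ [p h1 Qp]]]] := SP _ (lP n).
  exists h => _; split=> //.
  - by exists K => // y /MA; exact: PK.
  - by move=> y v t /MA; exact: hQ.
  - by exists p => // y /MA; exact: Qp.
pose O n := \bigcup_(M in mu n) M.
have oO n : open (O n).
  by apply: bigcup_open => M muM; have [+ _ _] := muP n; apply.
have cO x : exists n, O n x.
  by have [M [n _ muM] Mx] := cmu x; exists n, M.
have [lam [clam lam01 lam1 lam0 lamfin]] := @paracompact_bump R X O pX oO cO.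
have /choice[mem memP] : forall nx : nat * X, exists M, O nx.1 nx.2 ->
    mu nx.1 M /\ M nx.2.
  move=> [n x] /=; have [[M muM Mx]|nO] := pselect (O n x); last by exists set0.
  by exists M.
pose f := fix f n : X -> V := if n is n'.+1 then fun x =>
  if pselect (O n' x) is left _ then h (n', mem (n', x)) (f n' x, lam n' x)
  else f n' x else f0.
(* Disjointness makes the chosen member equal to [M], so a single homotopy defines [f n.+1] on all
   of [M]. *)
have fM n M y : mu n M -> M y -> f n.+1 y = h (n, M) (f n y, lam n y).
  move=> muM My; rewrite /f -/f; case: pselect => [Oy|nO]; last first.
    by case: nO; exists M.
  have [muM' M'y] := memP (n, y) Oy; congr (h (n, _) _).
  apply: contrapT => MM'; have [_ dmu _] := muP n.
  have : (mem (n, y) `&` M) y by [].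
  by rewrite (dmu _ _ muM' muM MM').
have f0E n y : lam n y = 0 -> f n.+1 y = f n y.
  move=> l0; have [[M muM My]|nO] := pselect (O n y).
    by rewrite (fM _ _ _ muM My) l0; have [->] := hP (n, M) muM.
  by rewrite /f -/f; case: pselect.
have nbhsM n M x : mu n M -> M x -> nbhs x M.
  move=> muM Mx; apply: open_nbhs_nbhs; split=> //.
  by have [+ _ _] := muP n; apply.
(* [D n] is where some earlier step has already erased the influence of [f0]; continuity and values
   in [P n] are claimed only there. *)
pose D n (x : X) := exists2 k, (k < n)%N & \forall y \near x, lam k y = 1.
have nbhsD n x : D n x -> \forall y \near x, D n y.
  by move=> [k kn /nbhs_interior]; apply: filterS => y lk; exists k.
have fP n x : D n x -> {for x, continuous (f n)} /\ P n x (f n x).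
  elim: n x => [|n IH] x [k]; first by rewrite ltn0.
  rewrite ltnS leq_eqVlt => /orP[/eqP -> l1|kn lk].
    have [M muM Mx] : O n x.
      apply: contrapT => /lam0 l0.
      have [y [/= -> /eqP]] := filter_ex (filterI l1 l0).
      by rewrite oner_eq0.
    have [_ _ _ [p h1 Pp]] := hP (n, M) muM.
    have fp : \forall y \near x, f n.+1 y = p.
      apply: filterS2 l1 (nbhsM _ _ _ muM Mx) => y l1 My.
      by rewrite (fM _ _ _ muM My) l1.
    split; first exact: near_cst_continuous fp.
    by rewrite (nbhs_singleton fp); exact: Pp.
  have Dx : D n x by exists k.
  have [cfx Pfx] := IH x Dx.
  have [[M muM Mx]|nO] := pselect (O n x); last first.
    have fE : \forall y \near x, f n.+1 y = f n y.
      by apply: filterS (lam0 _ _ nO) => y; exact: f0E.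
    have fx := nbhs_singleton fE.
    split; last first.
      by rewrite fx; have [_ _ _ PP _] := SP _ (lP n); exact: PP.
    change (f n.+1 @ x --> f n.+1 x); rewrite fx.
    by apply: cvg_trans cfx; apply: near_eq_cvg; apply: filterS fE => y ->.
  (* As [h] is continuous only within [K] times the interval, [f n y] must lie in [K] for [y] near
     [x]: [D n] is open and the induction hypothesis applies at [y]. *)
  have [_ [K ch PK] hQ _] := hP (n, M) muM.
  have fx := fM _ _ _ muM Mx.
  split; last by rewrite fx; exact: hQ.
  have zL : (K `*` `[0, 1]%classic) (f n x, lam n x).
    by split; [exact: PK Pfx|exact: lam01].
  have cpair : (f n y, lam n y) @[y --> x] --> (f n x, lam n x).
    exact: (@cvg_pair _ _ _ (nbhs x) (nbhs (f n x)) (nbhs (lam n x)) _ _ _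
      (f n) (lam n) cfx (clam n x)).
  change (f n.+1 @ x --> f n.+1 x); rewrite fx => W hW.
  have /subspace_continuousP/(_ _ zL _ hW) := ch => /cpair /=.
  rewrite /nbhs /= => hWx.
  apply: filterS3 hWx (nbhsD _ _ Dx) (nbhsM _ _ _ muM Mx) => y hWy Dy My.
  change (W (f n.+1 y)); rewrite (fM _ _ _ muM My); apply: hWy.
  split; last exact: lam01.
  by have [_] := IH y Dy; exact: PK.
have /choice[m mP] : forall x : X, exists m, \forall y \near x,
    forall n, (m <= n)%N -> f n y = f m y.
  move=> x; have [[N B] /= [Nx [m _ mB]] NB] := lamfin x.
  exists m; apply: filterS Nx => y Ny n; elim: n => [|n IH].
    by rewrite leqn0 => /eqP ->.
  rewrite leq_eqVlt => /orP[/eqP -> //|mn].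
  by rewrite f0E ?IH//; apply: (NB (y, n)); split=> //; exact: mB.
exists (fun x => f (m x) x).
suff main x : exists n, D n x /\ \forall y \near x, f (m y) y = f n y.
  split=> x; have [n [/fP[cf Pf] fE]] := main x; have fx := nbhs_singleton fE.
    change ((fun y => f (m y) y) @ x --> f (m x) x); rewrite fx.
    by apply: cvg_trans cf; apply: near_eq_cvg; apply: filterS fE => y ->.
  rewrite fx.
  have [K [_ KPhi /nbhs_singleton PK]] := lP n x.
  exact/KPhi/PK.
have [k lk] := lam1 x; exists (maxn (m x) k.+1); split.
  by exists k => //; rewrite leq_max ltnSn orbT.
apply: filterS (mP x) => y mxy.
(* Both stable values, at [m y] and at [m x], are compared at one index beyond both. *)
have := nbhs_singleton (mP y) (maxn (m y) (maxn (m x) k.+1)) (leq_maxl _ _).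
rewrite mxy; last by rewrite maxnCA leq_maxl.
by move=> <-; rewrite [RHS]mxy// leq_maxl.
Qed.

Theorem theorem2 (R : realType) (V : completeNormedModType R)
  (X : topologicalType) (C : set V) (Z U : X -> set V) :
  paracompact X -> C_space X -> convex_subset C ->
  (forall x, Z_set C (Z x)) ->
  (forall x, U x `<=` C /\ U x !=set0 /\ convex_subset (U x)) ->
  rel_closed [set p : X * V | C p.2] [set p : X * V | Z p.1 p.2] ->
  rel_open [set p : X * V | C p.2] [set p : X * V | U p.1 p.2] ->
  exists f : X -> V, continuous f /\ forall x, (U x `\` Z x) (f x).
Proof.
move=> pX CX cvxC zZ cvxU [_ [G cG ZE]] [_ [W oW UE]].
have UP x v : U x v <-> W (x, v) /\ C v.
  by rewrite -[U x v]/([set p : X * V | U p.1 p.2] (x, v)) UE.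
have ZP x v : Z x v <-> G (x, v) /\ C v.
  by rewrite -[Z x v]/([set p : X * V | Z p.1 p.2] (x, v)) ZE.
apply: (@C_space_selection R X V (fun x => U x `\` Z x)) => // x K cK KUZ.
  (* Tube argument over [K]: since [K] lies in the fixed set [C], membership in the fibre over [y]
     reduces to the open condition [W] minus [G]. *)
  have oWG : open (W `\` G) by apply: openI => //; exact: closed_openC.
  have /compact_near_coveringP/near_covering_withinP nK := cK.
  apply: (nK _ (nbhs x) (fun y v => (U y `\` Z y) v)) => v Kv.
  have [/UP[Wv Cv] nZv] := KUZ v Kv.
  have nGv : ~ G (x, v) by move=> Gv; apply: nZv; apply/ZP.
  have [[A B] /= [Ax Bv] AB] := open_nbhs_nbhs (conj oWG (conj Wv nGv)).
  exists (B, A) => // -[w y] /= [Bw Ay] Kw.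
  have [Ww nGw] : (W `\` G) (y, w) by exact: AB.
  have [/UP[_ Cw] _] := KUZ w Kw.
  by split=> [|/ZP[Gw _]]; [exact/UP|exact: nGw].
have [UC [U0 cU]] := cvxU x.
apply: (Z_set_contraction cvxC (zZ x) cU _ U0 cK KUZ); split=> //.
exists [set v | W (x, v)]; last by apply/seteqP; split=> v /UP.
apply: (@open_comp _ _ (fun v => (x, v))) => // v _.
exact: (@cvg_pair _ _ _ _ (nbhs x) (nbhs v) _ _ _ _ _ (cvg_cst x) cvg_id).
Qed.
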